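(* Let $X$ and $Y$ be $L$-spaces, $(T,r)$ a metric compact, $\omega$ a modulus of continuity, $\lambda\in\mathcal H(X,Y)$, $\varphi\in\mathcal M(T)$, let $\chi\in B(T,\mathbb R)$ be non-negative with $\varphi(\chi)>0$, $\Lambda\in\mathcal L(\lambda,\varphi)$ and $t\in T$. Then $$\sup_{f\in H^\omega(T,X),\ \Lambda(\chi f)=\theta}h_Y(\lambda(f(t)),\theta)\le\tfrac{1}{\varphi(\chi)}\varphi\big(\omega(r(t,\cdot))\chi(\cdot)\big).$$ If, moreover, $X$ is isotropic, $\varphi$ is $\chi$-averaging, $\Lambda(u_x)=\lambda(x)\varphi(u_+)+\lambda(x')\varphi(u_-)$ for all $x\in X^{\rm c}\cap X^{\rm inv}$ and $u\in B(T,\mathbb R)$, and the set $$\tilde X=\{x\in X^{\rm inv}\cap X^{\rm c}:\ \lambda(x)\in Y^{\rm inv}\cap Y^{\rm c},\ \lambda(x')=(\lambda(x))'\}$$ contains a $\lambda$-extremal sequence, then the inequality becomes an equality.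
   Context: Semilinear space: a set $X$ with addition and multiplication by reals such that for all $x,y,z\in X$, $\alpha,\beta\in\mathbb R$: $x+y=y+x$; $x+(y+z)=(x+y)+z$; there is $\theta$ with $x+\theta=x$; $\alpha(x+y)=\alpha x+\alpha y$; $\alpha(\beta x)=(\alpha\beta)x$; $1\cdot x=x$, $0\cdot x=\theta$. $x$ is convex if $(\alpha+\beta)x=\alpha x+\beta x$ for all $\alpha,\beta\ge0$ ($X^{\rm c}$: convex elements); $x$ is invertible if some $x'$ satisfies $x+x'=\theta$ ($x'$ unique, the inverse; $X^{\rm inv}$: invertible elements). An $L$-space is a semilinear space with a complete separable metric $h_X$ satisfying $h_X(\alpha x,\alpha y)=|\alpha|h_X(x,y)$ and $h_X(x+z,y+z)\le h_X(x,y)$; isotropic if the latter is always equality. $\theta$ denotes the zero of the relevant space. Modulus of continuity: non-decreasing continuous $\omega\colon[0,\infty)\to[0,\infty)$, $\omega(0)=0$, $\omega(a+b)\le\omega(a)+\omega(b)$; $H^\omega(T,X)=\{f\colon T\to X: h_X(f(s),f(t))\le\omega(r(s,t))\}$. $f\colon T\to X$ is measurable if $h_X(f(\cdot),x)$ is Borel measurable for all $x$; $B(T,X)$, $B(T,\mathbb R)$: bounded measurable functions. $(u\cdot x)(t)=u(t)x$, $(\chi f)(t)=\chi(t)f(t)$. For real $\xi$, $\xi_\pm=\max\{\pm\xi,0\}$, $u_\pm(t)=(u(t))_\pm$; for $u\colon T\to\mathbb R$ and $x\in X^{\rm inv}$, $u_x(t)=u_+(t)x+u_-(t)x'$. $\mathcal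 H(X,Y)$: maps $\lambda\colon X\to Y$ with $\lambda(\alpha x)=\alpha\lambda(x)$ ($\alpha\ge0$) and $h_Y(\lambda(x),\lambda(y))\le h_X(x,y)$. $\mathcal M(T)$: functionals $\varphi\colon B(T,\mathbb R)\to\mathbb R$ with $\varphi(u)\le\varphi(v)$ whenever $0\le u\le v$. $\mathcal L(\lambda,\varphi)$: operators $\Lambda\colon B(T,X)\to Y$ with $h_Y(\Lambda f,\Lambda g)\le\varphi(t\mapsto h_Y(\lambda(f(t)),\lambda(g(t))))$ for all $f,g$, and $\Lambda(u\cdot x)=\varphi(u)\lambda(x)$ for non-negative $u\in B(T,\mathbb R)$, $x\in X$. $\varphi$ is $\chi$-averaging if $\varphi(\chi)\ne0$ and for every non-negative $u\in B(T,\mathbb R)$ the function $\psi=u-\varphi(u\chi)/\varphi(\chi)$ satisfies $\varphi(\psi_+\chi)=\varphi(\psi_-\chi)$. A sequence $\{x_n\}\subset X$ is $\lambda$-extremal if $h_X(x_n,\theta)=1$ for all $n$ and $h_Y(\lambda(x_n),\theta)\to1$. *)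

(* Defs.v *)
From HB Require Import structures.
From mathcomp Require Import all_boot all_order all_algebra.
From mathcomp Require Import all_classical all_reals all_analysis.
From mathcomp Require Import Rstruct Rstruct_topology.
Set Implicit Arguments. Unset Strict Implicit. Unset Printing Implicit Defensive.
Import Order.TTheory GRing.Theory Num.Theory.
Local Open Scope classical_set_scope.
Local Open Scope ring_scope.

Notation RR := Rdefinitions.R.

Record semilinear := SemiLinear {
  sl_car :> Type;
  sl_add : sl_car -> sl_car -> sl_car;
  sl_smul : RR -> sl_car -> sl_car;
  sl_zero : sl_car;
  sl_addC : forall x y, sl_add x y = sl_add y x;
  sl_addA : forall x y z, sl_add x (sl_add y z) = sl_add (sl_add x y) z;
  sl_add0 : forall x, sl_add x sl_zero = x;
  sl_smulDr : forall (a : RR) x y, sl_smul a (sl_add x y) = sl_add (sl_smul a x) (sl_smul a y);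
  sl_smulA : forall (a b : RR) x, sl_smul a (sl_smul b x) = sl_smul (a * b) x;
  sl_smul1 : forall x, sl_smul 1 x = x;
  sl_smul0 : forall x, sl_smul 0 x = sl_zero }.

Arguments sl_add {s}.
Arguments sl_smul {s}.
Arguments sl_zero {s}.

Definition is_convex (X : semilinear) (x : X) :=
  forall a b : RR, 0 <= a -> 0 <= b -> sl_smul (a + b) x = sl_add (sl_smul a x) (sl_smul b x).

Definition is_inverse (X : semilinear) (x x' : X) := sl_add x x' = sl_zero.

Definition is_invertible (X : semilinear) (x : X) := exists x', is_inverse x x'.

Definition is_metric (T : Type) (d : T -> T -> RR) :=
  [/\ forall x y, 0 <= d x y,
      forall x y, d x y = 0 <-> x = y,
      forall x y, d x y = d y x &
      forall x y z, d x z <= d x y + d y z].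

Definition metric_complete (T : Type) (d : T -> T -> RR) :=
  forall u : nat -> T,
    (forall e : RR, 0 < e -> exists N, forall m n, (N <= m)%N -> (N <= n)%N -> d (u m) (u n) < e) ->
    exists x, forall e : RR, 0 < e -> exists N, forall n, (N <= n)%N -> d (u n) x < e.

Definition metric_separable (T : Type) (d : T -> T -> RR) :=
  exists s : nat -> T, forall x (e : RR), 0 < e -> exists n, d x (s n) < e.

Record Lsp := LSpace {
  ls_sl :> semilinear;
  ls_h : ls_sl -> ls_sl -> RR;
  ls_metric : is_metric ls_h;
  ls_complete : metric_complete ls_h;
  ls_separable : metric_separable ls_h;
  ls_hom : forall (a : RR) x y, ls_h (sl_smul a x) (sl_smul a y) = `|a| * ls_h x y;
  ls_transl : forall x y z, ls_h (sl_add x z) (sl_add y z) <= ls_h x y }.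

Arguments ls_h {l}.

Definition isotropic (X : Lsp) :=
  forall x y z : X, ls_h (sl_add x z) (sl_add y z) = ls_h x y.

Definition r_open (T : Type) (r : T -> T -> RR) (A : set T) :=
  forall x, A x -> exists e : RR, 0 < e /\ forall y, r x y < e -> A y.

Definition metric_compact (T : Type) (r : T -> T -> RR) :=
  is_metric r /\
  forall (I : Type) (U : I -> set T),
    (forall i, r_open r (U i)) -> (forall x, exists i, U i x) ->
    exists s : list I, forall x, exists i, List.In i s /\ U i x.

Definition borel_sets (T : Type) (r : T -> T -> RR) : set (set T) :=
  <<s r_open r >>.

(* Borel measurability of a real function on (T, r)
   (Borel sets of the reals = [measurable] sets of the canonical measurableType on R) *)
Definition borel_fun (T : Type) (r : T -> T -> RR) (u : T -> RR) :=
  forall B : set RR, @measurable _ (measurableTypeR RR) B -> borel_sets r (u @^-1` B).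

Definition meas_X (T : Type) (r : T -> T -> RR) (X : Lsp) (f : T -> X) :=
  forall x : X, borel_fun r (fun t => ls_h (f t) x).

Definition BTX (T : Type) (r : T -> T -> RR) (X : Lsp) (f : T -> X) :=
  meas_X r f /\ exists M : RR, forall t, ls_h (f t) sl_zero <= M.

Definition BTR (T : Type) (r : T -> T -> RR) (u : T -> RR) :=
  borel_fun r u /\ exists M : RR, forall t, `|u t| <= M.

Definition ppart (a : RR) : RR := Num.max a 0.
Definition npart (a : RR) : RR := Num.max (- a) 0.

Definition modulus (w : RR -> RR) :=
  [/\ forall a, 0 <= a -> 0 <= w a,
      forall a b, 0 <= a -> a <= b -> w a <= w b,
      {within [set a : RR | 0 <= a], continuous w},
      w 0 = 0 &
      forall a b, 0 <= a -> 0 <= b -> w (a + b) <= w a + w b].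

Definition H_omega (T : Type) (r : T -> T -> RR) (w : RR -> RR) (X : Lsp) (f : T -> X) :=
  forall s t, ls_h (f s) (f t) <= w (r s t).

Definition Hcal (X Y : Lsp) (lam : X -> Y) :=
  (forall (a : RR) x, 0 <= a -> lam (sl_smul a x) = sl_smul a (lam x)) /\
  (forall x y, ls_h (lam x) (lam y) <= ls_h x y).

Definition Mcal (T : Type) (r : T -> T -> RR) (phi : (T -> RR) -> RR) :=
  forall u v, BTR r u -> BTR r v -> (forall t, 0 <= u t /\ u t <= v t) -> phi u <= phi v.

Definition Lcal (T : Type) (r : T -> T -> RR) (X Y : Lsp) (lam : X -> Y)
    (phi : (T -> RR) -> RR) (Lam : (T -> X) -> Y) :=
  (forall f g, BTX r f -> BTX r g ->
     ls_h (Lam f) (Lam g) <= phi (fun t => ls_h (lam (f t)) (lam (g t)))) /\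
  (forall (u : T -> RR) (x : X), BTR r u -> (forall t, 0 <= u t) ->
     Lam (fun t => sl_smul (u t) x) = sl_smul (phi u) (lam x)).

Definition averaging (T : Type) (r : T -> T -> RR) (phi : (T -> RR) -> RR) (chi : T -> RR) :=
  phi chi != 0 /\
  forall u, BTR r u -> (forall t, 0 <= u t) ->
    let psi := fun t => u t - phi (fun s => u s * chi s) / phi chi in
    phi (fun t => ppart (psi t) * chi t) = phi (fun t => npart (psi t) * chi t).

Definition in_Xtilde (X Y : Lsp) (lam : X -> Y) (x : X) :=
  is_convex x /\ is_convex (lam x) /\
  exists x' : X, is_inverse x x' /\ is_inverse (lam x) (lam x').

Definition extremal_in_Xtilde (X Y : Lsp) (lam : X -> Y) :=
  exists xs : nat -> X,
    (forall n, in_Xtilde lam (xs n)) /\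
    (forall n, ls_h (xs n) sl_zero = 1) /\
    (fun n => ls_h (lam (xs n)) sl_zero) @ \oo --> (1 : RR).

Definition sup_set (T : Type) (r : T -> T -> RR) (w : RR -> RR) (X Y : Lsp)
    (lam : X -> Y) (Lam : (T -> X) -> Y) (chi : T -> RR) (t : T) : set (\bar RR) :=
  [set (ls_h (lam (f t)) sl_zero)%:E | f in
     [set f : T -> X | H_omega r w f /\ BTX r (fun s => sl_smul (chi s) (f s)) /\
                       Lam (fun s => sl_smul (chi s) (f s)) = sl_zero]].

(* Main.v *)
Require Import Defs.
From HB Require Import structures.
From mathcomp Require Import all_boot all_order all_algebra.
From mathcomp Require Import all_classical all_reals all_analysis.
From mathcomp Require Import measurable_realfun Rstruct Rstruct_topology ring lra.
Import Order.TTheory GRing.Theory Num.Theory.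
Local Open Scope classical_set_scope.
Local Open Scope ring_scope.

(** Upper bound: compare [Lam (chi f) = 0] with [Lam (chi . f(t)) = phi(chi) lam(f(t))].
    The axioms of an L-space do not make [a |-> a x] continuous, nor even Borel (twist the
    scalars of the plane by a discontinuous rotation), so [chi . f(t)] need not belong to
    [B(T, X)]. Instead [chi] is replaced by [u] with [u = chi] where
    [w(r(t, .)) chi] vanishes (there [chi f = chi . f(t)]) and [u] countably valued elsewhere,
    within a factor [1 + e] of [chi] and such that
    [h(u f(t), chi f) <= (1 + e) w(r(t, .)) chi]. Countably many values suffice because
    [X] is separable. If [lam(f(t))] is not zero then [phi] is positively homogeneous,
    and [e] can be sent to [0].

    Equality: for [x] in the extremal sequence take [f = psi_x] with [psi = w(r(t, .)) - c],
    [c] being the right-hand side. Averaging gives [Lam (chi f) = 0], isotropy gives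
    [f] in [H^w], and [f(t) = c x']. *)

(** * Inverses and convex elements of a semilinear space *)

Section SemilinearTheory.
Context {X : Defs.semilinear}.
Implicit Types x y : X.

Lemma sl_add0l x : sl_add sl_zero x = x.
Proof. by rewrite sl_addC sl_add0. Qed.

Lemma sl_smulr0 (a : RR) : sl_smul a sl_zero = sl_zero :> X.
Proof. by rewrite -(sl_smul0 sl_zero) sl_smulA mulr0 sl_smul0. Qed.

Lemma is_inverse_sym x x' : is_inverse x x' -> is_inverse x' x.
Proof. by rewrite /is_inverse sl_addC. Qed.

Lemma is_inverse_smul (a : RR) x x' :
  is_inverse x x' -> is_inverse (sl_smul a x) (sl_smul a x').
Proof. by rewrite /is_inverse -sl_smulDr => ->; rewrite sl_smulr0. Qed.

Lemma sl_addACA x1 x2 x3 x4 : sl_add (sl_add x1 x2) (sl_add x3 x4) =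
  sl_add (sl_add x1 x3) (sl_add x2 x4).
Proof.
by rewrite -!sl_addA; congr sl_add; rewrite !sl_addA; congr sl_add; exact: sl_addC.
Qed.

Lemma is_inverse_add x x' y y' :
  is_inverse x x' -> is_inverse y y' -> is_inverse (sl_add x y) (sl_add x' y').
Proof. by rewrite /is_inverse sl_addACA => -> ->; rewrite sl_add0. Qed.

Lemma is_inverse_uniq x x1 x2 : is_inverse x x1 -> is_inverse x x2 -> x1 = x2.
Proof.
move=> x1P x2P.
by rewrite -(sl_add0 x1) -x2P sl_addA (sl_addC x1) x1P sl_add0l.
Qed.

(** Both sides of the convexity identity for [x'] are inverses of [(a + b) x], and inverses are
    unique. *)
Lemma is_convex_inverse x x' : is_convex x -> is_inverse x x' -> is_convex x'.
Proof.
move=> cx xx' a b a0 b0.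
apply: (@is_inverse_uniq (sl_smul (a + b) x)); first exact: is_inverse_smul.
by rewrite cx//; apply: is_inverse_add; exact: is_inverse_smul.
Qed.

End SemilinearTheory.

(** * Distance estimates in an L-space *)

Section LspaceTheory.
Context {X : Lsp}.
Implicit Types x y z : X.

Lemma ls_ge0 x y : 0 <= ls_h x y. Proof. by case: (ls_metric X). Qed.
Lemma ls_sym x y : ls_h x y = ls_h y x. Proof. by case: (ls_metric X). Qed.
Lemma ls_tri y x z : ls_h x z <= ls_h x y + ls_h y z.
Proof. by case: (ls_metric X). Qed.
Lemma ls_xx x : ls_h x x = 0.
Proof. by case: (ls_metric X) => _ h0 _ _; exact/h0. Qed.
Lemma ls_eq0 x y : ls_h x y = 0 -> x = y.
Proof. by case: (ls_metric X) => _ h0 _ _; move/h0. Qed.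

Lemma ls_smul_norm (a : RR) x : ls_h (sl_smul a x) sl_zero = `|a| * ls_h x sl_zero.
Proof. by rewrite -(sl_smulr0 a) ls_hom sl_smulr0. Qed.

(** Translation by [x'] carries the pair [sl_zero], [x] to [x'], [sl_zero] and does not increase
    distance; exchanging the roles of [x] and [x'] gives the other inequality. *)
Lemma ls_inverse_norm x x' : is_inverse x x' -> ls_h x' sl_zero = ls_h x sl_zero.
Proof.
have le y y' : is_inverse y y' -> ls_h y' sl_zero <= ls_h y sl_zero.
  move=> yy'; have := ls_transl sl_zero y y'.
  by rewrite yy' sl_add0l [ls_h sl_zero y]ls_sym.
by move=> xx'; apply/eqP; rewrite eq_le !le//; exact: is_inverse_sym.
Qed.

Lemma ls_convex_dist x (a b : RR) : is_convex x -> 0 <= a -> 0 <= b ->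
  ls_h (sl_smul a x) (sl_smul b x) <= `|a - b| * ls_h x sl_zero.
Proof.
move=> cx; wlog ba : a b / b <= a => [hw a0 b0|].
  have [/hw|/ltW ab] := leP b a; first exact.
  by rewrite ls_sym distrC; exact: hw.
move=> a0 b0; rewrite -ls_smul_norm -{1}(subrK b a) (cx (a - b) b)// ?subr_ge0//.
by rewrite -[X in ls_h _ X]sl_add0l; exact: ls_transl.
Qed.

End LspaceTheory.

(* [u_x] at a point where [u] takes the value [a] *)
Definition signed_smul {X : Defs.semilinear} (x x' : X) (a : RR) : X :=
  sl_add (sl_smul (ppart a) x) (sl_smul (npart a) x').

(** * Positive and negative parts; signed multiples of an invertible element *)

Lemma ppart_pos (a : RR) : 0 <= a -> ppart a = a. Proof. exact: max_l. Qed.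
Lemma npart_neg (a : RR) : a <= 0 -> npart a = - a.
Proof. by move=> a0; apply: max_l; rewrite oppr_ge0. Qed.
Lemma ppart_neg (a : RR) : a <= 0 -> ppart a = 0. Proof. exact: max_r. Qed.
Lemma npart_pos (a : RR) : 0 <= a -> npart a = 0.
Proof. by move=> a0; apply: max_r; rewrite oppr_le0. Qed.
Lemma ppartMr (a b : RR) : 0 <= b -> ppart (a * b) = ppart a * b.
Proof. by move=> b0; rewrite /ppart maxr_pMl// mul0r. Qed.
Lemma npartMr (a b : RR) : 0 <= b -> npart (a * b) = npart a * b.
Proof. by move=> b0; rewrite /npart maxr_pMl// mul0r mulNr. Qed.

Section SignedSmul.
Context {X : Lsp} {x x' : X}.
Hypotheses (iX : isotropic X) (cx : is_convex x) (xx' : is_inverse x x').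

Lemma signed_smul_pos a : 0 <= a -> signed_smul x x' a = sl_smul a x.
Proof.
by move=> a0; rewrite /signed_smul ppart_pos// npart_pos// sl_smul0 sl_add0.
Qed.

Lemma signed_smul_neg a : a <= 0 -> signed_smul x x' a = sl_smul (- a) x'.
Proof.
by move=> a0; rewrite /signed_smul ppart_neg// npart_neg// sl_smul0 sl_add0l.
Qed.

Lemma smul_signed_smul a b : 0 <= b ->
  sl_smul b (signed_smul x x' a) = signed_smul x x' (a * b).
Proof.
move=> b0.
by rewrite /signed_smul sl_smulDr !sl_smulA ppartMr// npartMr// ![b * _]mulrC.
Qed.

(** Equal signs reduce to [ls_convex_dist] for [x] or [x']. For opposite signs, isotropy allows
    adding [- b x] to both points, which become [(a - b) x] and zero. *)
Lemma signed_smul_dist a b :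
  ls_h (signed_smul x x' a) (signed_smul x x' b) <= `|a - b| * ls_h x sl_zero.
Proof.
wlog ab : a b / b <= a => [hw|].
  have [/hw//|/ltW /hw] := leP b a.
  by rewrite ls_sym distrC.
have [b0|/ltW b0] := leP 0 b.
  by rewrite !signed_smul_pos ?(le_trans b0)//; apply: ls_convex_dist; rewrite ?(le_trans b0).
have [a0|/ltW a0] := leP 0 a.
  rewrite signed_smul_pos// signed_smul_neg//.
  rewrite -(iX _ _ (sl_smul (- b) x)) -cx ?oppr_ge0//.
  by rewrite (is_inverse_smul _ _ _ (is_inverse_sym _ _ xx')) ls_smul_norm.
rewrite !signed_smul_neg//.
rewrite -(ls_inverse_norm _ _ xx') (_ : `|a - b| = `|- a - - b|).
  by apply: ls_convex_dist; rewrite ?oppr_ge0//; exact: is_convex_inverse cx xx'.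
by rewrite -opprD normrN.
Qed.

Lemma signed_smul_norm a : ls_h (signed_smul x x' a) sl_zero <= `|a| * ls_h x sl_zero.
Proof.
have := signed_smul_dist a 0.
by rewrite subr0 (signed_smul_pos 0)// sl_smul0.
Qed.

End SignedSmul.

(** * The Borel sigma-algebra of [(T, r)] and measurable gluing *)

Definition pointed_at {T : Type} (t : T) : Type := T.
HB.instance Definition _ T t := gen_eqMixin (@pointed_at T t).
HB.instance Definition _ T t := gen_choiceMixin (@pointed_at T t).
HB.instance Definition _ T t := isPointed.Build (@pointed_at T t) t.

(** The bare type [T], given classical equality and choice and the base point [t], becomes a
    measurable type whose measurable sets are [borel_sets r]. *)
Definition borel_type {T : Type} (r : T -> T -> RR) (t : T) :=
  g_sigma_algebraType (r_open r : set (set (pointed_at t))).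
HB.instance Definition _ T r t := Measurable.on (@borel_type T r t).

Lemma borel_funP {T : Type} {r : T -> T -> RR} (t : T) (u : T -> RR) :
  borel_fun r u <-> measurable_fun [set: borel_type r t] (u : borel_type r t -> measurableTypeR RR).
Proof.
split=> [bu _ B mB|mu B mB]; first by rewrite setTI; exact: bu.
by have := mu measurableT _ mB; rewrite setTI.
Qed.

Lemma measurable_fun_ltP {R : realType} d (S : measurableType d) (u : S -> R) :
  (forall c : R, measurable [set s | u s < c]) -> measurable_fun [set: S] u.
Proof.
move=> mu; apply: (measurability _ (RGenInftyO.measurableE R)) => _ [_ [c ->] <-].
by rewrite setTI; exact: mu.
Qed.

(** [k s] is the least [n] with [A n s], so its level sets are the [A n] minus the earlier ones. *)
Lemma measurable_first_index d (S : measurableType d) (A : nat -> set S) :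
  (forall n, measurable (A n)) -> (forall s, exists n, A n s) ->
  exists k : S -> nat, (forall s, A (k s) s) /\ forall n, measurable [set s | k s = n].
Proof.
move=> mA exA.
have exAb s : exists n, `[< A n s >] by have [n ?] := exA s; exists n; exact/asboolP.
exists (fun s => ex_minn (exAb s)); split=> [s|n].
  by case: ex_minnP => m /asboolP.
rewrite [X in measurable X](_ : _ = A n `&` \bigcap_(i in [set i | (i < n)%N]) ~` A i).
  by apply: measurableI => //; apply: bigcap_measurableType => i _; exact: measurableC.
apply/seteqP; split=> [s /= <-|s [/= Ans minn]].
  case: ex_minnP => m /asboolP Ams mmin; split=> // i /= im Ais.
  by have := mmin i (asboolT Ais); rewrite leqNgt im.
case: ex_minnP => m /asboolP Ams mmin.
apply/eqP; rewrite eqn_leq mmin; last exact/asboolP.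
by rewrite leqNgt; apply/negP => /minn; exact.
Qed.

Lemma measurable_piecewise d d' (S : measurableType d) (S' : measurableType d')
    (k : S -> nat) (G : nat -> S -> S') :
  (forall n, measurable [set s | k s = n]) ->
  (forall n, measurable_fun [set: S] (G n)) ->
  measurable_fun [set: S] (fun s => G (k s) s).
Proof.
move=> mk mG _ B mB; rewrite setTI.
rewrite [X in measurable X](_ : _ =
    \bigcup_n ([set s | k s = n] `&` ([set: S] `&` G n @^-1` B))).
  by apply: bigcup_measurable => n _; apply: measurableI => //; exact: mG.
apply/seteqP; split=> [s /= Bs|s [n _ [/= <- [_ //]]]].
by exists (k s).
Qed.

(** * Stability properties of real Borel functions *)

Section BorelFun.
Context {T : Type} {r : T -> T -> RR} (t : T).
Implicit Types u v : T -> RR.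

Lemma borel_fun_ltP u : (forall c, borel_sets r [set s | u s < c]) -> borel_fun r u.
Proof.
move=> hu; apply/(borel_funP t).
by apply: (@measurable_fun_ltP RR _ (borel_type r t)).
Qed.

Lemma borel_fun_cst (c : RR) : borel_fun r (fun=> c).
Proof. by apply/(borel_funP t); exact: measurable_cst. Qed.

Lemma borel_funD u v : borel_fun r u -> borel_fun r v -> borel_fun r (fun s => u s + v s).
Proof.
move=> /(borel_funP t) mu /(borel_funP t) mv; apply/(borel_funP t).
exact: (@measurable_funD _ (borel_type r t) RR).
Qed.

Lemma borel_funM u v : borel_fun r u -> borel_fun r v -> borel_fun r (fun s => u s * v s).
Proof.
move=> /(borel_funP t) mu /(borel_funP t) mv; apply/(borel_funP t).
exact: (@measurable_funM _ (borel_type r t) RR).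
Qed.

Lemma borel_set_lt u v : borel_fun r u -> borel_fun r v ->
  borel_sets r [set s | u s < v s].
Proof.
move=> /(borel_funP t) mu /(borel_funP t) mv.
have := @measurable_fun_ltr _ (borel_type r t) RR _ _ _ mu mv measurableT [set true] I.
by rewrite setTI; congr borel_sets; apply/seteqP; split.
Qed.

Lemma borel_set_le u v : borel_fun r u -> borel_fun r v ->
  borel_sets r [set s | u s <= v s].
Proof.
move=> /(borel_funP t) mu /(borel_funP t) mv.
have := @measurable_fun_ler _ (borel_type r t) RR _ _ _ mu mv measurableT [set true] I.
by rewrite setTI; congr borel_sets; apply/seteqP; split.
Qed.

Lemma borel_fun_comp (g : measurableTypeR RR -> measurableTypeR RR) u :
  measurable_fun [set: measurableTypeR RR] g ->
  borel_fun r u -> borel_fun r (g \o u).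
Proof.
move=> mg bu B mB; have := mg measurableT _ mB; rewrite setTI => /bu.
exact.
Qed.

Lemma borel_fun_dist : is_metric r -> borel_fun r (r t).
Proof.
case=> _ _ rC rT; apply: borel_fun_ltP => c; apply: sub_sigma_algebra => s /= rc.
exists (c - r t s); split=> [|s' ss']; first by rewrite subr_gt0.
by rewrite (le_lt_trans (rT _ s _))// -ltrBrDl.
Qed.

Lemma borel_fun_lipschitz (L : RR) (g : RR -> RR) u :
  (forall a b, `|g a - g b| <= L * `|a - b|) -> borel_fun r u ->
  borel_fun r (fun s => g (u s)).
Proof.
move=> gL; apply: (@borel_fun_comp g); apply: (@continuous_measurable_fun RR) => a.
apply/cvgrPdist_lt => e e0; near=> b.
rewrite (le_lt_trans (gL _ _))//.
(* The sign of [L] is not prescribed; [|L| + 1] is a positive Lipschitz constant by which one can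
   divide. *)
have L0 : 0 < `|L| + 1 by rewrite ltr_wpDl.
rewrite (@le_lt_trans _ _ ((`|L| + 1) * `|a - b|))//.
  by rewrite ler_wpM2r// (le_trans (ler_norm _))// lerDl.
rewrite mulrC -ltr_pdivlMr//; near: b.
by apply/nbhs_ballP; exists (e / (`|L| + 1)) => //=; exact: divr_gt0.
Unshelve. all: by end_near. Qed.

Lemma borel_fun_modulus w : is_metric r -> modulus w -> borel_fun r (fun s => w (r t s)).
Proof.
move=> rm [w0 wle _ _ _].
(* [w] is monotone only on nonnegative arguments; truncation at 0 makes it nondecreasing on the
   whole line, hence Borel. *)
rewrite (_ : (fun s => w (r t s)) = (fun a => w (Num.max a 0)) \o r t); last first.
  by apply/funext => s /=; case: rm => r0 _ _ _; rewrite max_l.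
apply: borel_fun_comp; last exact: borel_fun_dist.
apply: (@nondecreasing_measurable RR) => // a b ab.
apply: wle; first by rewrite le_max lexx orbT.
by rewrite ge_max !le_max lexx ab orbT.
Qed.

End BorelFun.

(** * Borel functions built from maps into an L-space *)

Section BorelMaps.
Context {T : Type} {r : T -> T -> RR} (t : T) {X Y : Lsp}.

(* The function is the infimum over the points [p], [q] of a countable dense set of
   [K p q + L (d(F,p) + d(G,q))], a countable family of Borel functions. *)
Lemma borel_fun_lipschitz2 (L : RR) (K : X -> X -> RR) (F G : T -> X) : 0 <= L ->
  (forall p q p' q', K p q <= K p' q' + L * (ls_h p p' + ls_h q q')) ->
  meas_X r F -> meas_X r G -> borel_fun r (fun s => K (F s) (G s)).
Proof.
move=> L0 KL mF mG; have [d dP] := ls_separable X.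
apply: (borel_fun_ltP t) => c.
rewrite (_ : [set _ | _] = \bigcup_i \bigcup_j [set s |
    K (d i) (d j) + L * (ls_h (F s) (d i) + ls_h (G s) (d j)) < c]).
  apply: (@bigcup_measurable _ (borel_type r t)) => i _.
  apply: (@bigcup_measurable _ (borel_type r t)) => j _.
  apply: (borel_set_lt t); last exact: borel_fun_cst.
  apply: (borel_funD t); first exact: borel_fun_cst.
  apply: (borel_funM t); first exact: borel_fun_cst.
  by apply: (borel_funD t); [exact: mF|exact: mG].
apply/seteqP; split=> [s /= Kc|s [i _ [j _ /=]]]; last first.
  by apply: le_lt_trans; exact: KL.
(* Passing to the dense points and back costs at most [2 L A]; this [e] makes [L A] at most a
   quarter of the gap below [c]. The [+ 1] covers [L = 0]. *)
pose e := (c - K (F s) (G s)) / (8 * (L + 1)).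
have e0 : 0 < e by rewrite divr_gt0 ?subr_gt0//; lra.
have [i iP] := dP (F s) _ e0; have [j jP] := dP (G s) _ e0.
exists i => //; exists j => //=.
have := KL (d i) (d j) (F s) (G s); rewrite ![ls_h (d _) _]ls_sym.
set A := ls_h _ _ + ls_h _ _ => KA.
have LA : L * A <= (L + 1) * (2 * e).
  apply: ler_pM => //; rewrite ?addr_ge0 ?ls_ge0 ?lerDl//.
  by rewrite /A mulr_natl mulr2n lerD// ltW.
have eE : (L + 1) * (2 * e) = (c - K (F s) (G s)) / 4.
  have L1 : L + 1 != 0 by rewrite gt_eqF//; lra.
  by rewrite /e; field.
rewrite eE in LA.
by move: Kc KA LA; lra.
Qed.

(** Makes the integrand in the definition of [Lcal] Borel, so that monotonicity of [phi] applies to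
    it. The distance of images is 1-Lipschitz in each argument. *)
Lemma borel_fun_Hcal (lam : X -> Y) (F G : T -> X) : Hcal lam ->
  meas_X r F -> meas_X r G -> borel_fun r (fun s => ls_h (lam (F s)) (lam (G s))).
Proof.
move=> [_ lamL]; apply: (@borel_fun_lipschitz2 1 (fun p q => ls_h (lam p) (lam q))) => //.
move=> p q p' q'.
have := ls_tri (lam p') (lam p) (lam q); have := ls_tri (lam q') (lam p') (lam q).
have := lamL p p'; have := lamL q q'; rewrite [ls_h (lam q') _]ls_sym.
lra.
Qed.

End BorelMaps.


(** * Countable codes and joint approximation *)

Lemma separable_code {U : Type} {d : U -> U -> RR} (e : RR) :
  is_metric d -> metric_separable d -> 0 < e ->
  exists c : U -> nat, forall x y, c x = c y -> d x y < e.
Proof.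
move=> [_ _ dC dT] [p pP] e0.
have e20 : 0 < e / 2 by rewrite divr_gt0.
have [c cP] := choice (fun x => pP x _ e20).
exists c => x y cxy; have := cP y; rewrite -cxy dC => ycx.
by have := dT x (p (c x)) y; have := cP x; move: ycx; lra.
Qed.

Lemma nonneg_code {T : Type} {u : T -> RR} (e : RR) : (forall s, 0 <= u s) -> 0 < e ->
  exists c : T -> nat, forall s s', c s = c s' -> `|u s - u s'| < e.
Proof.
move=> u0 e0; exists (fun s => Num.truncn (u s / e)) => s s' ss'.
have ue v : 0 <= u v / e by rewrite divr_ge0// ltW.
have := truncn_itv (ue s); have := truncn_itv (ue s'); rewrite -ss'.
rewrite !ler_pdivlMr// !ltr_pdivrMr// -natr1 mulrDl mul1r.
by rewrite ltr_norml => /andP[? ?] /andP[? ?]; apply/andP; split; lra.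
Qed.

(* Subsets of the separable space [R * X * X] are separable. *)
Lemma joint_dense_sequence {T : Type} {X : Lsp} (t : T) (u : T -> RR) (f g : T -> X) :
  (forall s, 0 <= u s) ->
  exists p : nat -> T, forall s (e : RR), 0 < e ->
    exists n, [/\ `|u s - u (p n)| < e, ls_h (f s) (f (p n)) < e
                & ls_h (g s) (g (p n)) < e].
Proof.
move=> u0.
have /choice[c cP] (m : nat) : exists c : T -> nat * nat * nat, forall s s', c s = c s' ->
    [/\ `|u s - u s'| < m.+1%:R^-1, ls_h (f s) (f s') < m.+1%:R^-1
      & ls_h (g s) (g s') < m.+1%:R^-1].
  have m0 : 0 < m.+1%:R^-1 :> RR by rewrite invr_gt0.
  have [c1 c1P] := nonneg_code _ u0 m0.
  have [c2 c2P] := separable_code _ (ls_metric X) (ls_separable X) m0.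
  exists (fun s => (c1 s, c2 (f s), c2 (g s))) => s s' [? ? ?].
  by split; [exact: c1P|exact: c2P|exact: c2P].
(* One representative for each mesh and code triple; the default [t] serves triples that no point
   attains. *)
pose pick (k : nat * (nat * nat * nat)) : T :=
  if pselect (exists s, c k.1 s = k.2) is left h then sval (cid h) else t.
exists (fun n => if unpickle n is Some k then pick k else t) => s e e0.
have [m me] : exists m : nat, m.+1%:R^-1 < e.
  exists (Num.truncn e^-1); rewrite invf_plt ?posrE//.
  have /truncn_itv/andP[_ ->//] : 0 <= e^-1 by rewrite invr_ge0 ltW.
exists (pickle (m, c m s)); rewrite pickleK /pick.
case: pselect => [h|]; last by case; exists s.
case: (cid h) => s' /= /esym /cP[? ? ?].
by split; apply: lt_trans me.
Qed.

(** * Bounded Borel functions on a metric compact *)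

Lemma BTR_bounded {T : Type} {r : T -> T -> RR} (u v : T -> RR) : borel_fun r u ->
  (forall s, 0 <= u s <= v s) -> BTR r v -> BTR r u.
Proof.
move=> bu uv [_ [M vM]]; split => //; exists M => s.
have /andP[u0 uv'] := uv s.
by rewrite ger0_norm// (le_trans uv')// (le_trans (ler_norm _)).
Qed.

Lemma BTR_mul {T : Type} {r : T -> T -> RR} (t : T) (u v : T -> RR) :
  BTR r u -> BTR r v -> BTR r (fun s => u s * v s).
Proof.
move=> [bu [M uM]] [bv [N vN]]; split; first exact: (borel_funM t).
by exists (M * N) => s; rewrite normrM ler_pM.
Qed.

Lemma BTR_sub_cst {T : Type} {r : T -> T -> RR} (t : T) (u : T -> RR) (c : RR) :
  BTR r u -> BTR r (fun s => u s - c).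
Proof.
move=> [bu [M uM]]; split.
  by apply: (borel_funD t) => //; exact: (borel_fun_cst t).
by exists (M + `|c|) => s; rewrite (le_trans (ler_normB _ _))// lerD2r.
Qed.

Lemma BTR_scale {T : Type} {r : T -> T -> RR} (t : T) (u : T -> RR) (c : RR) :
  BTR r u -> BTR r (fun s => c * u s).
Proof.
apply: (BTR_mul t); split; first exact: (borel_fun_cst t).
by exists `|c|.
Qed.

Lemma metric_compact_bounded {T : Type} {r : T -> T -> RR} (t : T) :
  metric_compact r -> exists M : RR, forall s, r t s <= M.
Proof.
move=> [[r0 _ rC rT] cT].
have [n s|s|l lP] := cT nat (fun n => [set s | r t s < n%:R]).
- move=> /= rn; exists (n%:R - r t s); split=> [|s' ss']; first by rewrite subr_gt0.
  by rewrite (le_lt_trans (rT _ s _))// -ltrBrDl.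
- exists (Num.truncn (r t s)).+1 => /=.
  by have /andP[] := truncn_itv (r0 t s).
(* The sum of the finitely many radii replaces their maximum. *)
exists (\sum_(i <- l) i%:R) => s; have [i [il /= /ltW ri]] := lP s.
apply: (le_trans ri); elim: l il {lP} => //= j l IH [->|/IH il]; rewrite big_cons.
  by rewrite lerDl sumr_ge0.
by rewrite (le_trans il)// lerDr.
Qed.

Lemma BTR_modulus {T : Type} {r : T -> T -> RR} {w : RR -> RR} (t : T) :
  metric_compact r -> modulus w -> BTR r (fun s => w (r t s)).
Proof.
move=> cT mw; split; first by apply: borel_fun_modulus => //; case: cT.
have [M rM] := metric_compact_bounded t cT.
case: mw cT => w0 wle _ _ _ [[r0 _ _ _] _].
by exists (w M) => s; rewrite ger0_norm ?w0// wle.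
Qed.

(* Multiplication of [x] by scalars need not be Borel in an L-space, so [chi . f(t)] may
   fail to be measurable; [u] is a substitute for [chi] for which [u . f(t)] is. *)
Lemma measurable_weight {T : Type} {r : T -> T -> RR} {X : Lsp} {w : RR -> RR}
    {chi : T -> RR} {f : T -> X} {t : T} {e : RR} :
  metric_compact r -> modulus w -> borel_fun r chi -> (forall s, 0 <= chi s) ->
  H_omega r w f -> meas_X r (fun s => sl_smul (chi s) (f s)) -> 0 < e ->
  exists u : T -> RR,
    [/\ borel_fun r u, meas_X r (fun s => sl_smul (u s) (f t)),
        forall s, (1 - e) * chi s <= u s <= (1 + e) * chi s, forall s, 0 <= u s
      & forall s, ls_h (sl_smul (u s) (f t)) (sl_smul (chi s) (f s))
                  <= (1 + e) * (w (r t s) * chi s)].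
Proof.
move=> cT mw bchi chi0 fH mg e0.
have bw : borel_fun r (fun s => w (r t s)) := (BTR_modulus t cT mw).1.
have w0 s : 0 <= w (r t s).
  by case: mw cT => + _ _ _ _ [[r0 _ _ _] _]; apply; exact: r0.
pose g s := sl_smul (chi s) (f s).
have [p pP] := joint_dense_sequence t chi f g chi0.
(* [A m.+1] collects the points where the constant [chi (p m)] is an admissible value for [u]; on
   [A 0] the value [chi s] itself is kept. *)
pose A n := if n is m.+1 then
    [set s | (1 - e) * chi s <= chi (p m)] `&` [set s | chi (p m) <= (1 + e) * chi s] `&`
    [set s | ls_h (g s) (sl_smul (chi (p m)) (f t)) <= (1 + e) * (w (r t s) * chi s)]
  else [set s | w (r t s) * chi s <= 0].
have bcst := @borel_fun_cst T r t.
have bM u v := @borel_funM T r t u v.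
have bA n : @measurable _ (borel_type r t) (A n).
  case: n => [|m].
    by apply: (borel_set_le t); [exact: bM|exact: bcst].
  apply: measurableI; first apply: measurableI; apply: (borel_set_le t).
  - exact: (bM _ _ (bcst _) bchi).
  - exact: bcst.
  - exact: bcst.
  - exact: (bM _ _ (bcst _) bchi).
  - exact: mg.
  - exact: (bM _ _ (bcst _) (bM _ _ bw bchi)).
have covA s : exists n, A n s.
  have [wc|wc] := leP (w (r t s) * chi s) 0; first by exists 0%N.
  have c0 : 0 < chi s.
    by rewrite lt0r chi0 andbT; apply: contraTneq wc => ->; rewrite mulr0 ltxx.
  (* The bound [e * chi s] keeps [chi (p n)] within the factors [1 - e] and [1 + e]. The total
     distance error is at most [d (chi s + w + d) + d], which for [d <= 1] the last bound absorbs
     into [e * (w * chi s)]. *)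
  pose d := Num.min 1 (Num.min (e * chi s) (e * (w (r t s) * chi s) / (chi s + w (r t s) + 2))).
  have D0 : 0 < chi s + w (r t s) + 2 by have := w0 s; lra.
  have d0 : 0 < d by rewrite !lt_min ltr01 (mulr_gt0 e0 c0) divr_gt0// mulr_gt0.
  have d1 : d <= 1 by rewrite ge_min lexx.
  have d2 : d <= e * chi s by rewrite !ge_min lexx orbT.
  have d3 : d * (chi s + w (r t s) + 2) <= e * (w (r t s) * chi s).
    by rewrite -ler_pdivlMr// !ge_min lexx !orbT.
  have [n [n1 n2 n3]] := pP s d d0; exists n.+1 => /=.
  move: n1; rewrite ltr_norml => /andP[n1 n1'].
  split; first by split; rewrite /= ?mulrBl ?mulrDl mul1r; lra.
  have H1 := ls_tri (g (p n)) (g s) (sl_smul (chi (p n)) (f t)).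
  have H2 := ls_tri (f s) (f (p n)) (f t).
  have H3 : ls_h (f s) (f t) <= w (r t s) by rewrite ls_sym; exact: fH.
  have H4 : ls_h (g (p n)) (sl_smul (chi (p n)) (f t)) <= (chi s + d) * (w (r t s) + d).
    rewrite /g ls_hom ger0_norm// ler_pM ?ls_ge0//; first by lra.
    by move: H2; rewrite [ls_h (f (p n)) (f s)]ls_sym; lra.
  rewrite /= (le_trans H1)// mulrDl mul1r.
  have H5 : (chi s + d) * (w (r t s) + d) =
    w (r t s) * chi s + d * (chi s + w (r t s) + d) by ring.
  have H6 : d * (chi s + w (r t s) + d) <= d * (chi s + w (r t s) + 1).
    by rewrite ler_pM2l// lerD2l.
  have H7 : d * (chi s + w (r t s) + 2) = d * (chi s + w (r t s) + 1) + d by ring.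
  lra.
have [k [kA bk]] := @measurable_first_index _ (borel_type r t) A bA covA.
pose G n s := if n is m.+1 then chi (p m) else chi s.
pose u s := G (k s) s.
(* A vanishing product means [chi s = 0] or [w (r t s) = 0]; the latter forces [f s = f t]. *)
have uA s : A 0%N s -> sl_smul (chi s) (f t) = g s.
  move=> /= wc; have : w (r t s) * chi s = 0.
    by apply/eqP; rewrite eq_le wc mulr_ge0.
  move/eqP; rewrite mulf_eq0 => /orP[/eqP wr|/eqP c]; last by rewrite /g c !sl_smul0.
  rewrite /g (@ls_eq0 _ (f s) (f t))//; apply/eqP; rewrite eq_le ls_ge0 andbT.
  by rewrite ls_sym -wr; exact: fH.
exists u; split.
- apply/(borel_funP t); apply: (@measurable_piecewise _ _ (borel_type r t) (measurableTypeR RR) k G) => // n.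
  by apply/(borel_funP t); case: n => [|m] /=; [exact: bchi|exact: bcst].
(* On [A 0] the vector [u s] times [f t] equals [g s], measurable by hypothesis; on every other
   piece it is constant. *)
- move=> z; pose H n s := if n is m.+1 then ls_h (sl_smul (chi (p m)) (f t)) z
    else ls_h (g s) z.
  rewrite (_ : (fun s => _) = (fun s => H (k s) s)).
    apply/(borel_funP t); apply: (@measurable_piecewise _ _ (borel_type r t) (measurableTypeR RR) k H) => // n.
    by apply/(borel_funP t); case: n => [|m] /=; [exact: mg|exact: bcst].
  apply/funext => s; have := kA s; rewrite /u /G /H.
  by case: (k s) => [/uA ->|].
- move=> s; have := kA s; rewrite /u /G.
  case: (k s) => [_|n [[/= -> ->]//]].
  by have := chi0 s => ?; apply/andP; split; nra.
- by move=> s; rewrite /u /G; case: (k s).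
- move=> s; have := kA s; rewrite /u /G.
  case: (k s) => [/uA ->|n [_ /=]]; last by rewrite ls_sym.
  by rewrite -/(g s) ls_xx !mulr_ge0//; lra.
Qed.

(** * The upper bound *)

Section UpperBound.
Context {X Y : Lsp} {T : Type} {r : T -> T -> RR} {w : RR -> RR} {lam : X -> Y}
  {phi : (T -> RR) -> RR} {chi : T -> RR} {Lam : (T -> X) -> Y} (t : T).
Hypotheses (cT : metric_compact r) (mw : modulus w) (lamH : Hcal lam)
  (phiM : Mcal r phi) (chiB : BTR r chi) (chi0 : forall s, 0 <= chi s)
  (LamL : Lcal r lam phi Lam).

Lemma BTR_cst (c : RR) : BTR r (fun=> c).
Proof. by split; [exact: (borel_fun_cst t)|exists `|c|]. Qed.

Lemma BTX_zero : BTX r (fun=> sl_zero : X).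
Proof.
by split=> [z|]; [exact: (borel_fun_cst t)|exists 0 => s; rewrite ls_xx].
Qed.

(** By monotonicity it suffices that [phi 0] is nonnegative: it bounds the distance from [Lam 0] to
    itself. *)
Lemma Mcal_ge0 (u : T -> RR) : BTR r u -> (forall s, 0 <= u s) -> 0 <= phi u.
Proof.
move=> uB u0; apply: (@le_trans _ _ (phi (fun=> 0))).
  have := LamL.1 _ _ BTX_zero BTX_zero; rewrite ls_xx => /le_trans; apply.
  by apply: phiM; [rewrite ls_xx; exact: BTR_cst|exact: BTR_cst|rewrite ls_xx].
by apply: phiM => //; exact: BTR_cst.
Qed.

(* Both sides weight [lam x] in the value of [Lam] at the same function. *)
Lemma Mcal_homogeneous (x : X) (a : RR) (u : T -> RR) : lam x <> sl_zero ->
  0 <= a -> BTR r u -> (forall s, 0 <= u s) -> phi (fun s => a * u s) = a * phi u.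
Proof.
move=> lx a0 uB u0.
have auB := BTR_scale t u a uB.
have au0 s : 0 <= a * u s by rewrite mulr_ge0.
have := LamL.2 _ (sl_smul a x) uB u0.
rewrite (_ : (fun s => _) = (fun s => sl_smul (a * u s) x)); last first.
  by apply/funext => s; rewrite sl_smulA mulrC.
rewrite LamL.2// lamH.1// sl_smulA => /(congr1 (fun y => ls_h y sl_zero)).
rewrite !ls_smul_norm !ger0_norm ?mulr_ge0 ?Mcal_ge0// [phi u * a]mulrC.
by apply: mulIf; apply/eqP => /ls_eq0.
Qed.

Lemma null_value_bound (f : T -> X) : H_omega r w f ->
  BTX r (fun s => sl_smul (chi s) (f s)) ->
  Lam (fun s => sl_smul (chi s) (f s)) = sl_zero ->
  phi chi * ls_h (lam (f t)) sl_zero <= phi (fun s => w (r t s) * chi s).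
Proof.
move=> fH gB Lam0.
have w0 s : 0 <= w (r t s).
  by case: mw cT => + _ _ _ _ [[r0 _ _ _] _]; apply; exact: r0.
have wcB : BTR r (fun s => w (r t s) * chi s) := BTR_mul t _ _ (BTR_modulus t cT mw) chiB.
have wc0 s : 0 <= w (r t s) * chi s by rewrite mulr_ge0.
have [lx0|lx] := pselect (lam (f t) = sl_zero).
  by rewrite lx0 ls_xx mulr0 Mcal_ge0.
have phiZ := Mcal_homogeneous (f t) _ _ lx.
set N := ls_h _ _; have N0 : 0 <= N := ls_ge0 _ _.
(* Chain: [(1 - e) phi chi N <= phi u N], which is the distance between [Lam] of [u f(t)] and
   [Lam (chi f) = 0], hence at most [phi v], and [v <= (1 + e) w chi]. *)
have main (e : RR) : 0 < e -> e < 1 ->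
    (1 - e) * (phi chi * N) <= (1 + e) * phi (fun s => w (r t s) * chi s).
  move=> e0 e1; have [bchi _] := chiB.
  have e1' : 0 <= 1 - e by rewrite subr_ge0 ltW.
  have e1'' : 0 <= 1 + e by rewrite addr_ge0// ltW.
  have [u [bu mu uchi u0 hu]] := measurable_weight (t := t) cT mw bchi chi0 fH gB.1 e0.
  have uB : BTR r u.
    apply: (BTR_bounded _ (fun s => (1 + e) * chi s)) => // [s|]; last exact: BTR_scale.
    by have /andP[_ ->] := uchi s; rewrite u0.
  have uxB : BTX r (fun s => sl_smul (u s) (f t)).
    split=> //; have [_ [M uM]] := uB; exists (M * ls_h (f t) sl_zero) => s.
    by rewrite ls_smul_norm ler_wpM2r// ls_ge0.
  have := LamL.1 _ _ uxB gB; rewrite Lam0 LamL.2// ls_smul_norm ger0_norm ?Mcal_ge0// -/N.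
  set v := fun s => ls_h _ _ => phiv.
  have v1 s : 0 <= v s <= (1 + e) * (w (r t s) * chi s).
    by rewrite ls_ge0 (le_trans (lamH.2 _ _))// hu.
  have vB : BTR r v.
    apply: (BTR_bounded _ (fun s => (1 + e) * (w (r t s) * chi s))) => //.
      exact: (borel_fun_Hcal t _ _ _ lamH uxB.1 gB.1).
    exact: BTR_scale.
  rewrite -phiZ//; apply: (@le_trans _ _ (phi v)); last first.
    by apply: phiM => // [|s]; [exact: BTR_scale|exact/andP].
  apply: le_trans phiv; rewrite mulrA ler_wpM2r// -phiZ//.
  apply: phiM => //; first exact: BTR_scale.
  by move=> s; rewrite mulr_ge0//; have /andP[] := uchi s.
set P := phi chi * N in main *; set Q := phi _ in main *.
have P0 : 0 <= P by rewrite mulr_ge0 ?Mcal_ge0.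
have Q0 : 0 <= Q by rewrite Mcal_ge0.
rewrite leNgt; apply/negP => QP.
have PQ0 : 0 < P + Q by lra.
(* [main] rearranges to [P - Q <= e (P + Q)]; this [e] makes the right side half of [P - Q], a
   contradiction. *)
pose e := (P - Q) / (2 * (P + Q)).
have eE : e * (P + Q) = (P - Q) / 2 by rewrite /e; field; rewrite gt_eqF.
have e0 : 0 < e by rewrite divr_gt0 ?subr_gt0// mulr_gt0.
have e1 : e < 1 by rewrite ltr_pdivrMr ?mulr_gt0//; lra.
by have := main e e0 e1; nra.
Qed.

End UpperBound.

(** * The extremal functions *)

Lemma modulus_dist {T : Type} {r : T -> T -> RR} {w : RR -> RR} (t s s' : T) :
  is_metric r -> modulus w -> `|w (r t s) - w (r t s')| <= w (r s s').
Proof.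
move=> [r0 _ rC rT] [w0 wle _ _ wD].
have half a b : w (r t a) - w (r t b) <= w (r a b).
  rewrite lerBlDl; apply: le_trans (wD _ _ (r0 _ _) (r0 _ _)).
  by apply: wle => //; rewrite [r a b]rC; exact: rT.
by rewrite ler_norml half andbT lerNl opprB [r s s']rC.
Qed.

(** Under isotropy and convexity, signed multiples of [x] depend on the scalar in a Lipschitz way,
    so Borel measurability passes from [v] to the product. *)
Lemma BTX_signed_smul {T : Type} {r : T -> T -> RR} {X : Lsp} {x x' : X}
    (v : T -> RR) : isotropic X -> is_convex x -> is_inverse x x' -> BTR r v ->
  BTX r (fun s => signed_smul x x' (v s)).
Proof.
move=> iX cx xx' [bv [M vM]]; split=> [z|].
  apply: (borel_fun_lipschitz (ls_h x sl_zero)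
    (fun a => ls_h (signed_smul x x' a) z) v _ bv) => a b.
  have := signed_smul_dist iX cx xx' a b; rewrite mulrC.
  have := ls_tri (signed_smul x x' b) (signed_smul x x' a) z.
  have := ls_tri (signed_smul x x' a) (signed_smul x x' b) z.
  rewrite [ls_h (signed_smul x x' b) (signed_smul _ _ _)]ls_sym ler_norml.
  by move=> ? ? ?; apply/andP; split; lra.
exists (M * ls_h x sl_zero) => s.
by rewrite (le_trans (signed_smul_norm iX cx xx' _))// ler_wpM2r// ls_ge0.
Qed.

Lemma extremal_element {X Y : Lsp} {T : Type} {r : T -> T -> RR} {w : RR -> RR}
    {lam : X -> Y} {phi : (T -> RR) -> RR} {chi : T -> RR} {Lam : (T -> X) -> Y}
    (t : T) (x x' : X) :
  metric_compact r -> modulus w -> Hcal lam -> BTR r chi -> (forall s, 0 <= chi s) ->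
  isotropic X -> averaging r phi chi ->
  (forall u : T -> RR, BTR r u ->
     Lam (fun s => signed_smul x x' (u s)) =
     sl_add (sl_smul (phi (fun s => ppart (u s))) (lam x))
            (sl_smul (phi (fun s => npart (u s))) (lam x'))) ->
  is_convex x -> is_inverse x x' -> is_inverse (lam x) (lam x') -> ls_h x sl_zero = 1 ->
  let c := (phi chi)^-1 * phi (fun s => w (r t s) * chi s) in
  0 <= c -> sup_set r w lam Lam chi t (c * ls_h (lam x) sl_zero)%:E.
Proof.
move=> cT mw lamH chiB chi0 iX [_ avg] LamE cx xx' lxx' x1 c c0.
have rm := cT.1; have wB := BTR_modulus t cT mw.
have w0 s : 0 <= w (r t s) by case: mw rm => + _ _ _ _ [r0 _ _ _]; apply; exact: r0.
pose psi s := w (r t s) - c.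
have psiE : (fun s => sl_smul (chi s) (signed_smul x x' (psi s))) =
    (fun s => signed_smul x x' (psi s * chi s)).
  by apply/funext => s; rewrite smul_signed_smul.
have psiB : BTR r (fun s => psi s * chi s).
  by apply: (BTR_mul t) => //; exact: (BTR_sub_cst t).
exists (fun s => signed_smul x x' (psi s)).
  rewrite /= psiE; split=> [s s'|].
    rewrite (le_trans (signed_smul_dist iX cx xx' _ _))// x1 mulr1.
    by rewrite /psi opprB addrA subrK; exact: (modulus_dist t s s' rm mw).
  split; first exact: BTX_signed_smul.
  rewrite LamE//.
  under eq_fun do rewrite ppartMr//.
  under [X in sl_add _ (sl_smul (phi X) _)]eq_fun do rewrite npartMr//.
  (* For [u = w (r t .)] the mean subtracted in [averaging] is exactly [c], so both weights agree
     and multiply [lam x + lam x' = 0]. *)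
  have := avg _ wB w0; rewrite /= -[_ / phi chi]mulrC -/c => ->.
  by rewrite -sl_smulDr lxx' sl_smulr0.
have wrt0 : w (r t t) = 0.
  by case: mw rm => _ _ _ w00 _ [_ r00 _ _]; rewrite (r00 t t).2.
(* At [t] the scalar is [- c <= 0], so the function takes the value [c x']. *)
rewrite signed_smul_neg /psi wrt0 sub0r ?oppr_le0// opprK lamH.1//.
by rewrite ls_smul_norm ger0_norm// (ls_inverse_norm _ _ lxx').
Qed.

(** * Comparison of the supremum with the bound *)

Theorem theorem3 (X Y : Lsp) (T : Type) (r : T -> T -> RR) (w : RR -> RR)
    (lam : X -> Y) (phi : (T -> RR) -> RR) (chi : T -> RR) (Lam : (T -> X) -> Y) (t : T) :
  metric_compact r -> modulus w -> Hcal lam -> Mcal r phi ->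
  BTR r chi -> (forall s, 0 <= chi s) -> 0 < phi chi ->
  Lcal r lam phi Lam ->
  let RHS := (phi chi)^-1 * phi (fun s => w (r t s) * chi s) in
  (ereal_sup (sup_set r w lam Lam chi t) <= RHS%:E)%E /\
  (isotropic X -> averaging r phi chi ->
   (forall (x x' : X), is_convex x -> is_inverse x x' ->
      forall u : T -> RR, BTR r u ->
        Lam (fun s => sl_add (sl_smul (ppart (u s)) x) (sl_smul (npart (u s)) x')) =
        sl_add (sl_smul (phi (fun s => ppart (u s))) (lam x))
               (sl_smul (phi (fun s => npart (u s))) (lam x'))) ->
   extremal_in_Xtilde lam ->
   ereal_sup (sup_set r w lam Lam chi t) = RHS%:E).
Proof.
move=> cT mw lamH phiM chiB chi0 phichi LamL RHS.
have ub : (ereal_sup (sup_set r w lam Lam chi t) <= RHS%:E)%E.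
  apply: ge_ereal_sup => _ [f [fH [gB Lam0]] <-].
  rewrite lee_fin ler_pdivlMl//.
  exact: (null_value_bound t cT mw lamH phiM chiB chi0 LamL f).
split=> // iX avg LamE [xs [xsP [xs1 xslim]]].
have RHS0 : 0 <= RHS.
  rewrite mulr_ge0 ?invr_ge0 ?(ltW phichi)//.
  apply: (Mcal_ge0 t phiM LamL) => [|s]; first exact: (BTR_mul t _ _ (BTR_modulus t cT mw)).
  by rewrite mulr_ge0//; case: mw cT => + _ _ _ _ [[r0 _ _ _] _]; apply; exact: r0.
have lb n : ((RHS * ls_h (lam (xs n)) sl_zero)%:E <= ereal_sup (sup_set r w lam Lam chi t))%E.
  have [cx [_ [x' [xx' lxx']]]] := xsP n.
  by apply/ereal_sup_ubound/(extremal_element t _ x') => //; exact: LamE.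
(* The supremum is finite: [ub] excludes [+oo] and [lb] excludes [-oo]. It then remains to let [n]
   tend to infinity in [lb]. *)
apply/eqP; rewrite eq_le ub /=; move: ub lb.
case: (ereal_sup _) => [S| |] // _ lb; last by have := lb 0%N.
have RHSlim : (fun n => RHS * ls_h (lam (xs n)) sl_zero) @ \oo --> RHS * 1.
  by apply: (@cvgM RR) => //; exact: cvg_cst.
rewrite lee_fin -[RHS]mulr1; apply: (ler_cvg_to RHSlim (cvg_cst S)).
by apply: nearW => n; have := lb n; rewrite lee_fin.
Qed.
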